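(* Let $K$ be a field of characteristic zero and let $(\alpha_k)_{k\ge0},(\gamma_k)_{k\ge0},(\beta_k)_{k\ge0}$ be arbitrary sequences in $K$, defining a height-dependent weighted Motzkin rule with column series $H_k(t)=\sum_{n\ge0}w_{n,k}t^n/n!\in K[[t]]$. Assume $H_1\not\equiv0$. The following statements are equivalent: (1) there is a formal power series $Y\in K[[t]]$ with $Y(0)=0$ such that $H_k(t)=H_0(t)Y(t)^k$ for all $k\ge0$; (2) the step weights have the form, for all $k\ge0$, $$\alpha_k=(k+1)\alpha_0,\qquad \gamma_k=\gamma_0+k(\gamma_1-\gamma_0),\qquad \beta_k=\beta_0+k(\beta_1-\beta_0).$$ When these conditions hold, $W=H_0$ and $Y$ are uniquely determined by $$W'=(\gamma_0+\beta_0Y)W,\quad W(0)=1,$$ $$Y'=\alpha_0+(\gamma_1-\gamma_0)Y+(\beta_1-\beta_0)Y^2,\quad Y(0)=0,$$ and $H_k(t)=W(t)Y(t)^k$ for all $k\ge0$. Consequently, $w(x,t)=\sum_{n,k\ge0}w_{n,k}x^kt^n/n!$ satisfies $$w(x,t)=\frac{W(t)}{1-xY(t)}.$$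
   Context: Weighted Motzkin paths: a path starts at height $0$, never goes below height $0$, and uses steps $k\to k+1$ of weight $\alpha_k$, $k\to k$ of weight $\gamma_k$, and $k+1\to k$ of weight $\beta_k$ (down-steps indexed by arrival height), for $k\ge0$. The weight of a path is the product of its step weights (empty path: $1$), and $w_{n,k}$ is the total weight of all paths of length $n$ ending at height $k$. *)

(* Defs.v *)
From HB Require Import structures.
From mathcomp Require Import all_boot all_order all_algebra.
From mathcomp Require Import boolp.

Set Implicit Arguments.
Unset Strict Implicit.
Unset Printing Implicit Defensive.

Import GRing.Theory.
Local Open Scope ring_scope.

(** * Formal power series *)

(* [f n] is the coefficient of degree [n].  A record rather than an alias of
   [nat -> R], so that [fps R] does not inherit the pointwise product. *)
Record fps (R : Type) := FPS { fps_coef :> nat -> R }.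

Notation "{ 'fps' R }" := (fps R) (at level 0, R at level 2) : type_scope.

HB.instance Definition _ (R : Type) := gen_eqMixin {fps R}.
HB.instance Definition _ (R : Type) := gen_choiceMixin {fps R}.

Lemma fpsP (R : Type) (f g : {fps R}) : (forall n, f n = g n) <-> f = g.
Proof.
split=> [|-> //]; case: f g => [f] [g] /= fg.
by congr FPS; apply: funext.
Qed.

Section Zmodule.
Variable R : zmodType.
Implicit Types f g h : {fps R}.

Definition fps_zero : {fps R} := FPS (fun=> 0).
Definition fps_add f g : {fps R} := FPS (fun n => f n + g n).
Definition fps_opp f : {fps R} := FPS (fun n => - f n).

Fact fps_addA : associative fps_add.
Proof. by move=> f g h; apply/fpsP => n /=; rewrite addrA. Qed.
Fact fps_addC : commutative fps_add.
Proof. by move=> f g; apply/fpsP => n /=; rewrite addrC. Qed.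
Fact fps_add0 : left_id fps_zero fps_add.
Proof. by move=> f; apply/fpsP => n /=; rewrite add0r. Qed.
Fact fps_addN : left_inverse fps_zero fps_opp fps_add.
Proof. by move=> f; apply/fpsP => n /=; rewrite addNr. Qed.

HB.instance Definition _ := GRing.isZmodule.Build {fps R}
  fps_addA fps_addC fps_add0 fps_addN.

End Zmodule.

Section ComRing.
Variable R : comNzRingType.
Implicit Types f g h : {fps R}.

Definition fpsC (c : R) : {fps R} := FPS (fun n => if n == 0%N then c else 0).
Definition fpsX : {fps R} := FPS (fun n => (n == 1%N)%:R).
Definition fps_mul f g : {fps R} :=
  FPS (fun n => \sum_(i < n.+1) f i * g (n - i)%N).

Let trunc n f : {poly R} := \poly_(i < n.+1) f i.

Let coef_trunc n f i : (i <= n)%N -> (trunc n f)`_i = f i.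
Proof. by move=> lin; rewrite coef_poly ltnS lin. Qed.

Let mul_trunc n m f g : (m <= n)%N ->
  fps_mul f g m = (trunc n f * trunc n g)`_m.
Proof.
move=> lmn; rewrite coefM; apply: eq_bigr => i _.
have lim : (i <= m)%N by rewrite -ltnS.
by rewrite !coef_trunc ?(leq_trans _ lmn) // leq_subr.
Qed.

Fact fps_mulC : commutative fps_mul.
Proof.
by move=> f g; apply/fpsP => n; rewrite !(@mul_trunc n) // mulrC.
Qed.

Fact fps_mulA : associative fps_mul.
Proof.
move=> f g h; apply/fpsP => n.
transitivity ((trunc n f * (trunc n g * trunc n h))`_n).
  rewrite coefM; apply: eq_bigr => i _.
  by rewrite (@mul_trunc n) ?leq_subr // coef_trunc // -ltnS.
rewrite mulrA coefM; apply: eq_bigr => i _.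
have lin : (i <= n)%N by rewrite -ltnS.
by rewrite (@mul_trunc n) // coef_trunc // leq_subr.
Qed.

Fact fps_mul1 : left_id (fpsC 1) fps_mul.
Proof.
move=> f; apply/fpsP => n /=.
rewrite big_ord_recl /= mul1r subn0 big1 ?addr0 // => i _.
by rewrite mul0r.
Qed.

Fact fps_mulDl : left_distributive fps_mul +%R.
Proof.
move=> f g h; apply/fpsP => n /=; rewrite -big_split /=.
by apply: eq_bigr => i _; rewrite mulrDl.
Qed.

Fact fps_one_neq0 : fpsC 1 != 0.
Proof.
apply/eqP => /(congr1 (fun f : {fps R} => f 0%N)) /= /eqP.
by rewrite oner_eq0.
Qed.

HB.instance Definition _ := GRing.Zmodule_isComNzRing.Build {fps R}
  fps_mulA fps_mulC fps_mul1 fps_mulDl fps_one_neq0.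

(* Invertibility is the ring-theoretic one, and the inverse (unique when it
   exists) is obtained by choice. *)
Definition fps_unit : {pred {fps R}} := fun f => `[< exists g, g * f = 1 >].
Definition fps_inv f : {fps R} :=
  if pselect (exists g, g * f = 1) is left fV then sval (cid fV) else f.

Fact fps_mulVx : {in fps_unit, left_inverse 1 fps_inv *%R}.
Proof.
move=> f /asboolP fV; rewrite /fps_inv.
by case: pselect => // fV'; case: cid.
Qed.

Fact fps_unitPl f g : g * f = 1 -> fps_unit f.
Proof. by move=> gf; apply/asboolP; exists g. Qed.

Fact fps_inv_out : {in [predC fps_unit], fps_inv =1 id}.
Proof.
move=> f /asboolP fV; rewrite /fps_inv.
by case: pselect.
Qed.

HB.instance Definition _ := GRing.ComNzRing_hasMulInverse.Build {fps R}
  fps_mulVx fps_unitPl fps_inv_out.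

Definition fps_deriv f : {fps R} := FPS (fun n => f n.+1 *+ n.+1).

Lemma fpsD_coef f g n : (f + g) n = f n + g n. Proof. by []. Qed.
Lemma fpsN_coef f n : (- f) n = - f n. Proof. by []. Qed.
Lemma fps1_coef n : (1 : {fps R}) n = (n == 0%N)%:R.
Proof. by case: n. Qed.
Lemma fpsM_coef f g n : (f * g) n = \sum_(i < n.+1) f i * g (n - i)%N.
Proof. by []. Qed.

Lemma fpsXM_coef f n : (fpsX * f) n = if n is m.+1 then f m else 0.
Proof.
rewrite fpsM_coef big_ord_recl mul0r add0r.
case: n => [|n]; first by rewrite big_ord0.
rewrite big_ord_recl /= mul1r subn1 big1 ?addr0 // => i _.
by rewrite mul0r.
Qed.

Lemma fpsCM_coef c f n : (fpsC c * f) n = c * f n.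
Proof.
rewrite fpsM_coef big_ord_recl subn0 big1 ?addr0 // => i _.
by rewrite mul0r.
Qed.

(* [1 - c x] is invertible, so that dividing by it is meaningful. *)
Lemma fps_unit_1BX c : 1 - fpsX * fpsC c \is a GRing.unit.
Proof.
apply/asboolP; exists (FPS (fun n => c ^+ n)); apply/fpsP => n.
rewrite mulrC mulrBl mul1r -mulrA fpsD_coef fpsN_coef fpsXM_coef fps1_coef.
case: n => [|n]; first by rewrite subr0.
by rewrite fpsCM_coef /= -exprS subrr.
Qed.

End ComRing.

Arguments fpsX {R}.
Notation "c %:S" := (fpsC c) (at level 1, format "c %:S") : ring_scope.

(** * Weighted Motzkin paths *)

Inductive mstep := Up | Level | Down.

Definition ord_of_mstep (s : mstep) : 'I_3 :=
  match s with Up => inord 0 | Level => inord 1 | Down => inord 2 end.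
Definition mstep_of_ord (i : 'I_3) : mstep :=
  match val i with 0 => Up | 1 => Level | _ => Down end.

Fact ord_of_mstepK : cancel ord_of_mstep mstep_of_ord.
Proof. by case; rewrite /mstep_of_ord /= inordK. Qed.

HB.instance Definition _ := Countable.copy mstep (can_type ord_of_mstepK).
HB.instance Definition _ : isFinite mstep := CanIsFinite ord_of_mstepK.

(* Height reached from height [h]; in a valid path [Down] is only used when
   [0 < h]. *)
Definition next_height (h : nat) (s : mstep) : nat :=
  match s with Up => h.+1 | Level => h | Down => h.-1 end.

Fixpoint is_motzkin (h : nat) (p : seq mstep) : bool :=
  if p is s :: p'
  then ((s == Down) ==> (0 < h)%N) && is_motzkin (next_height h s) p'
  else true.

Definition end_height (h : nat) (p : seq mstep) : nat := foldl next_height h p.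

Section Weights.
Variables (K : fieldType) (alpha gamma beta : nat -> K).

Definition step_weight (h : nat) (s : mstep) : K :=
  match s with
  | Up => alpha h
  | Level => gamma h
  | Down => beta h.-1
  end.

Fixpoint path_weight (h : nat) (p : seq mstep) : K :=
  if p is s :: p'
  then step_weight h s * path_weight (next_height h s) p'
  else 1.

Definition motzkin_weight (n k : nat) : K :=
  \sum_(p : n.-tuple mstep | is_motzkin 0 p && (end_height 0 p == k))
     path_weight 0 p.

Definition column_series (k : nat) : {fps K} :=
  FPS (fun n => motzkin_weight n k / n`!%:R).

(* An element of K[[t]][[x]], identified with K[[x,t]]: the outer variable is x,
   the inner one is t. *)
Definition motzkin_gf : {fps {fps K}} :=
  FPS (fun k => FPS (fun n => motzkin_weight n k / n`!%:R)).

Definition motzkin_ode (W Y : {fps K}) : Prop :=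
  [/\ fps_deriv W = ((gamma 0)%:S + (beta 0)%:S * Y) * W,
      W 0%N = 1,
      fps_deriv Y = (alpha 0)%:S + (gamma 1 - gamma 0)%:S * Y
                + (beta 1 - beta 0)%:S * Y ^+ 2
    & Y 0%N = 0].

End Weights.

(* Main.v *)
Require Import Defs.
From HB Require Import structures.
From mathcomp Require Import all_boot all_order all_algebra.
From mathcomp Require Import ring.

Import GRing.Theory.
Local Open Scope ring_scope.

(** Deleting the last step of a path gives a recurrence in [n] for the weights
    [w_(n,k)], which on the exponential series [H k] of the columns reads
      [H k' = alpha (k-1) H (k-1) + gamma k H k + beta k H (k+1)],
    with [H k (0)] equal to 1 if [k = 0] and to 0 otherwise
    ([column_series_ode]).  In characteristic 0 this infinite system determines
    all the [H k], since each coefficient of degree [n+1] is a function of the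
    coefficients of degree [n] ([column_series_unique]).

    If [H k = W Y^k] with [W = H 0], the equation for [k = 0] says
    [W' = (gamma 0 + beta 0 Y) W].  In the equation for [k+1] everything is
    divisible by [W Y^k], a nonzero element of the domain [K[[t]]], and what
    remains is
      [(k+1) Y' = alpha k + (gamma (k+1) - gamma 0) Y
                  + (beta (k+1) - beta 0) Y^2].
    Comparing it with [k+1] times its instance at [k = 0] gives a relation
    between [1], [Y] and [Y^2] with constant coefficients.  These three series
    have distinct orders when [Y] is nonzero and [Y(0) = 0], so the coefficients
    of the relation vanish, which is the affine form of the weights
    ([geometric_columns_affine]).  The hypothesis on [H 1] ensures that [Y] is
    nonzero.

    Conversely, let [W] and [Y] solve the two differential equations of the
    statement; a solution exists and is unique by Picard iteration
    ([motzkin_ode_exists], [motzkin_ode_unique]).  For affine weights the series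
    [W Y^k] satisfy the system of the columns, hence equal the [H k]
    ([affine_geometric_columns]), and the generating function is a geometric
    series in [x] ([motzkin_gf_geometric]). *)

(** * Formal power series: constants, derivative, absence of zero divisors *)

Section FpsRing.
Variable R : comNzRingType.
Implicit Types f g h : {fps R}.

Fact fpsC_is_additive : zmod_morphism (@fpsC R).
Proof. by move=> a b; apply/fpsP => -[|n] //=; rewrite subr0. Qed.

Fact fpsC_is_monoid_morphism : monoid_morphism (@fpsC R).
Proof.
split=> // a b; apply/fpsP => n; rewrite fpsCM_coef /=.
by case: ifP; rewrite ?mulr0.
Qed.

HB.instance Definition _ :=
  GRing.isZmodMorphism.Build R {fps R} (@fpsC R) fpsC_is_additive.
HB.instance Definition _ :=
  GRing.isMonoidMorphism.Build R {fps R} (@fpsC R) fpsC_is_monoid_morphism.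

Lemma fpsM_coef0 f g : (f * g) 0%N = f 0%N * g 0%N.
Proof. by rewrite fpsM_coef big_ord1. Qed.

Lemma fps_exp_coef0 f k : (f ^+ k) 0%N = f 0%N ^+ k.
Proof. by elim: k => [|k IH]; rewrite ?fps1_coef // !exprS fpsM_coef0 IH. Qed.

(** The weight [n.+1] of the term [f i * g (n.+1 - i)] splits as [i] plus
    [n.+1 - i]; the first share vanishes at [i = 0] and the second one at
    [i = n.+1]. *)
Lemma fps_derivM f g :
  fps_deriv (f * g) = fps_deriv f * g + f * fps_deriv g.
Proof.
apply/fpsP => n; rewrite fpsD_coef /= -sumrMnl.
transitivity (\sum_(i < n.+2) (f i * g (n.+1 - i)%N *+ i
                              + f i * g (n.+1 - i)%N *+ (n.+1 - i))).
  by apply: eq_bigr => i _; rewrite -mulrnDr subnKC // -ltnS.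
rewrite big_split /= big_ord_recl mulr0n add0r; congr (_ + _).
  by apply: eq_bigr => i _; rewrite mulrnAl subSS.
rewrite big_ord_recr /= subnn mulr0n addr0.
apply: eq_bigr => i _.
by rewrite /= subSn ?mulrnAr // -ltnS.
Qed.

Lemma fps_deriv1 : fps_deriv (1 : {fps R}) = 0.
Proof. by apply/fpsP => n; rewrite /= mul0rn. Qed.

Lemma fps_derivX f k :
  fps_deriv (f ^+ k.+1) = k.+1%:R * (f ^+ k * fps_deriv f).
Proof.
elim: k => [|k IH]; first by rewrite expr0 expr1 !mul1r.
by rewrite exprS fps_derivM IH -[k.+2]addn1 natrD !exprS; ring.
Qed.

End FpsRing.

Section FpsDomain.
Variable K : fieldType.
Implicit Types f g h : {fps K}.

Lemma fps_order f :
  f != 0 -> exists v, f v != 0 /\ forall i, (i < v)%N -> f i = 0.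
Proof.
move=> f0; have fv : exists v, f v != 0.
  apply: boolp.contrapT => nf; case/eqP: f0; apply/fpsP => n /=.
  by apply/eqP/negPn/negP => fn; apply: nf; exists n.
case: (ex_minnP fv) => v fv0 vmin {fv}.
exists v; split=> // i; apply: contraTeq => fi.
by rewrite -leqNgt vmin.
Qed.

(** At the sum [u + v] of the orders of the factors, the only surviving term
    of the convolution is [f u * g v]. *)
Lemma fps_mulf_neq0 f g : f != 0 -> g != 0 -> f * g != 0.
Proof.
move=> /fps_order[u [fu f0]] /fps_order[v [gv g0]].
apply/eqP => /(congr1 (fun h : {fps K} => h (u + v)%N)) /eqP.
have ltu : (u < (u + v).+1)%N by rewrite ltnS leq_addr.
rewrite fpsM_coef (bigD1 (Ordinal ltu)) //= addKn big1 => [|i /= niu].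
  by rewrite addr0 mulf_eq0 (negbTE fu) (negbTE gv).
have [ltiu|ltui|eiu] := ltngtP (i : nat) u.
- by rewrite f0 ?mul0r.
- by rewrite g0 ?mulr0 // ltn_subLR ?ltn_add2r // -ltnS.
- by case/eqP: niu; apply: val_inj.
Qed.

Lemma fps_mulfI f g h : f != 0 -> f * g = f * h -> g = h.
Proof.
move=> f0 /eqP; rewrite -subr_eq0 -mulrBr => fgh; apply/eqP.
by rewrite -subr_eq0; apply: contraTT fgh; apply: fps_mulf_neq0.
Qed.

Lemma fps_expf_neq0 f k : f != 0 -> f ^+ k != 0.
Proof.
move=> f0; elim: k => [|k IH]; first by rewrite expr0 oner_neq0.
by rewrite exprS fps_mulf_neq0.
Qed.

(** Evaluating at 0 shows that [a = 0]; dividing by [Y] then brings [b] into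
    the constant position, and a second division does the same for [c]. *)
Lemma fps_quadratic_free (Y : {fps K}) (a b c : K) :
  Y != 0 -> Y 0%N = 0 -> a%:S + b%:S * Y + c%:S * Y ^+ 2 = 0 ->
  [/\ a = 0, b = 0 & c = 0].
Proof.
move=> Yn0 Y0 abc.
have a0 : a = 0.
  have := congr1 (fun h : {fps K} => h 0%N) abc.
  by rewrite !fpsD_coef !fpsM_coef0 Y0 mul0r !mulr0 !addr0.
have bc : b%:S + c%:S * Y = 0.
  apply: (fps_mulfI Y) => //; rewrite mulr0 -abc a0 rmorph0; ring.
have b0 : b = 0.
  have := congr1 (fun h : {fps K} => h 0%N) bc.
  by rewrite fpsD_coef fpsM_coef0 Y0 mulr0 addr0.
have c0 : c%:S = 0 :> {fps K}.
  by apply: (fps_mulfI Y) => //; rewrite mulr0 -bc b0 rmorph0; ring.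
by split=> //; have := congr1 (fun h : {fps K} => h 0%N) c0.
Qed.

End FpsDomain.

(** * Formal differential systems *)

Section Picard.
Variables (K : fieldType) (charK : [pchar K] =i pred0) (I : Type).
Implicit Types (F G : I -> {fps K}) (c : I -> K).

Definition agree_below n F G := forall i m, (m < n)%N -> F i m = G i m.

Lemma agree_belowW {m n F G} :
  (m <= n)%N -> agree_below n F G -> agree_below m F G.
Proof. by move=> lemn FG i p ltpm; apply: FG; apply: leq_trans lemn. Qed.

(** A right-hand side whose coefficients up to degree [n] involve the unknowns
    only up to degree [n]; the unknowns are a family, possibly infinite. *)
Definition causal (Phi : (I -> {fps K}) -> I -> {fps K}) :=
  forall n F G, agree_below n F G -> agree_below n (Phi F) (Phi G).

Definition picard (Phi : (I -> {fps K}) -> I -> {fps K}) c F : I -> {fps K} :=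
  fun i => FPS (fun n => if n is m.+1 then Phi F i m / n%:R else c i).

Lemma natS_neq0 n : n.+1%:R != 0 :> K.
Proof. by rewrite ((pcharf0P K).1 charK). Qed.

Lemma picard_fixpoint {Phi c F} :
  (forall i, F i = picard Phi c F i) <->
  (forall i, F i 0%N = c i /\ fps_deriv (F i) = Phi F i).
Proof.
split=> FP i.
  split; first by rewrite FP.
  apply/fpsP => n /=; rewrite FP /= -[LHS]mulr_natr divfK //.
  exact: natS_neq0.
have [F0 dF] := FP i; apply/fpsP => -[|n] //=.
by rewrite -dF /= -[X in X / _]mulr_natr mulfK ?natS_neq0.
Qed.

Lemma picard_agree {Phi c n F G} : causal Phi ->
  agree_below n F G -> agree_below n.+1 (picard Phi c F) (picard Phi c G).
Proof. by move=> cP FG i [|m] //= ltmn; rewrite (cP n F G FG). Qed.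

Lemma iter_picard_agree {Phi c n F G} : causal Phi ->
  agree_below n (iter n (picard Phi c) F) (iter n (picard Phi c) G).
Proof. by move=> cP; elim: n => [|n IH] //=; apply: picard_agree. Qed.

(** The coefficient of degree [n] is stationary along Picard iteration from
    step [n.+1] on, so the iterates converge coefficientwise. *)
Lemma causal_ode_exists Phi c : causal Phi ->
  exists F, forall i, F i 0%N = c i /\ fps_deriv (F i) = Phi F i.
Proof.
move=> cP; pose P := picard Phi c; pose Z : I -> {fps K} := fun=> 0.
pose F : I -> {fps K} := fun i => FPS (fun n => iter n.+1 P Z i n).
have stationary n : agree_below n F (iter n P Z).
  move=> i m /subnKC <-; rewrite iterD.
  by apply: (iter_picard_agree cP).
exists F; apply/picard_fixpoint => i; apply/fpsP => n.
by rewrite (picard_agree cP (stationary n)).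
Qed.

Lemma causal_ode_unique Phi c F G : causal Phi ->
  (forall i, F i 0%N = c i /\ fps_deriv (F i) = Phi F i) ->
  (forall i, G i 0%N = c i /\ fps_deriv (G i) = Phi G i) ->
  forall i, F i = G i.
Proof.
move=> cP /picard_fixpoint FP /picard_fixpoint GP i; apply/fpsP => n.
suff FG m : agree_below m F G by apply: (FG n.+1).
elim: m => [|m IH] j p // ltpm.
by rewrite FP GP (picard_agree cP IH).
Qed.

End Picard.

Lemma eq_fpsM_coef (R : comNzRingType) (f f' g g' : {fps R}) n :
  (forall m, (m <= n)%N -> f m = f' m) ->
  (forall m, (m <= n)%N -> g m = g' m) -> (f * g) n = (f' * g') n.
Proof.
move=> ff gg; rewrite !fpsM_coef; apply: eq_bigr => i _.
by rewrite ff ?gg ?leq_subr // -ltnS.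
Qed.

(** * Removing the last step of a path *)

Section Paths.
Variables (K : fieldType) (alpha gamma beta : nat -> K).

Lemma end_height_rcons h p s :
  end_height h (rcons p s) = next_height (end_height h p) s.
Proof. exact: foldl_rcons. Qed.

Lemma is_motzkin_rcons h p s :
  is_motzkin h (rcons p s)
  = is_motzkin h p && ((s == Down) ==> (0 < end_height h p)%N).
Proof. by elim: p h => [|x p IH] h /=; rewrite ?andbT // IH andbA. Qed.

Lemma path_weight_rcons h p s :
  path_weight alpha gamma beta h (rcons p s)
  = path_weight alpha gamma beta h p
    * step_weight alpha gamma beta (end_height h p) s.
Proof. by elim: p h => [|x p IH] h /=; rewrite ?mul1r ?mulr1 // IH mulrA. Qed.

Lemma eq_Down s : (s == Down) = if s is Down then true else false.
Proof. by case: s; apply/eqP. Qed.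

Lemma big_mstep (F : mstep -> K) : \sum_s F s = F Up + F Level + F Down.
Proof.
rewrite (bigD1 Up) //= (bigD1 Level) /=; last by apply/eqP.
rewrite (bigD1 Down) /=; last by apply/andP; split; apply/eqP.
by rewrite big1 ?addr0 ?addrA // => -[]; rewrite eqxx ?andbF.
Qed.

Lemma big_tuple_rcons n (P : pred (seq mstep)) (F : seq mstep -> K) :
  \sum_(p : n.+1.-tuple mstep | P p) F p
  = \sum_s \sum_(p : n.-tuple mstep | P (rcons p s)) F (rcons p s).
Proof.
pose app (q : mstep * n.-tuple mstep) : n.+1.-tuple mstep :=
  [tuple of rcons q.2 q.1].
have app_bij : bijective app.
  apply: inj_card_bij => [[s p] [s' p'] /(congr1 val) /= /rcons_inj[pp ->]|].
    by congr pair; apply: val_inj.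
  by rewrite card_prod !card_tuple expnS.
by rewrite pair_big_dep (reindex app) //=; apply: onW_bij.
Qed.

Lemma motzkin_weight0 k : motzkin_weight alpha gamma beta 0 k = (k == 0%N)%:R.
Proof.
rewrite /motzkin_weight big_mkcond (big_pred1 [tuple]) => [|p].
  by rewrite /= eq_sym; case: (_ == _).
by apply/esym/eqP/tuple0.
Qed.

Lemma motzkin_weightS n k :
  motzkin_weight alpha gamma beta n.+1 k
  = (if k is j.+1 then alpha j * motzkin_weight alpha gamma beta n j else 0)
    + gamma k * motzkin_weight alpha gamma beta n k
    + beta k * motzkin_weight alpha gamma beta n k.+1.
Proof.
rewrite {1}/motzkin_weight
  (big_tuple_rcons n (fun p => is_motzkin 0 p && (end_height 0 p == k))).
have last_step s j (c : K) :
    (forall h, ((s == Down) ==> (0 < h)%N) && (next_height h s == k)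
               = (h == j)) ->
    step_weight alpha gamma beta j s = c ->
  \sum_(p : n.-tuple mstep | is_motzkin 0 (rcons p s)
                             && (end_height 0 (rcons p s) == k))
    path_weight alpha gamma beta 0 (rcons p s)
  = c * motzkin_weight alpha gamma beta n j.
  move=> sj <-; rewrite mulr_sumr; apply: eq_big => [p|p].
    by rewrite is_motzkin_rcons end_height_rcons -andbA sj.
  rewrite is_motzkin_rcons end_height_rcons -andbA sj => /andP[_ /eqP <-].
  by rewrite path_weight_rcons mulrC.
rewrite big_mstep (last_step Level k (gamma k)) //; last by rewrite eq_Down.
rewrite (last_step Down k.+1 (beta k)) //=; last by rewrite eqxx; case.
congr (_ + _ + _); case: k last_step => [|k] last_step.
  by rewrite big_pred0 // => p; rewrite end_height_rcons andbF.
by apply: last_step => // h; rewrite eq_Down.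
Qed.

(** * The differential system of the column series *)

Definition column_rhs (F : nat -> {fps K}) (k : nat) : {fps K} :=
  (if k is j.+1 then (alpha j)%:S * F j else 0)
  + (gamma k)%:S * F k + (beta k)%:S * F k.+1.

Hypothesis charK : [pchar K] =i pred0.

Lemma column_rhs_causal : causal K nat column_rhs.
Proof.
move=> n F G FG k m ltmn.
rewrite !fpsD_coef !fpsCM_coef !(FG _ m) //.
by case: k => // k; rewrite !fpsCM_coef (FG _ m).
Qed.

(** Dividing by [n`!] turns the shift of [n] into differentiation. *)
Lemma column_series_ode k :
  column_series alpha gamma beta k 0%N = (k == 0%N)%:R /\
  fps_deriv (column_series alpha gamma beta k)
  = column_rhs (column_series alpha gamma beta) k.
Proof.
split; first by rewrite /= motzkin_weight0 fact0 divr1.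
apply/fpsP => n; rewrite !fpsD_coef !fpsCM_coef /= factS natrM motzkin_weightS.
rewrite -[LHS]mulr_natr mulrC invfM mulrCA mulVKf; last exact: natS_neq0.
by case: k => [|k]; rewrite ?fpsCM_coef /=; ring.
Qed.

Lemma column_series_unique (F : nat -> {fps K}) :
  (forall k, F k 0%N = (k == 0%N)%:R /\ fps_deriv (F k) = column_rhs F k) ->
  forall k, column_series alpha gamma beta k = F k.
Proof.
move=> Fode; apply: (causal_ode_unique K charK nat column_rhs) Fode.
  exact: column_rhs_causal.
exact: column_series_ode.
Qed.

Definition affine_weights :=
  forall k : nat,
    [/\ alpha k = k.+1%:R * alpha 0%N,
        gamma k = gamma 0%N + k%:R * (gamma 1%N - gamma 0%N)
      & beta k = beta 0%N + k%:R * (beta 1%N - beta 0%N)].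

(** By the Leibniz rule the derivative of [W * Y ^+ k] is
    [W * Y ^+ k.-1] times a quadratic polynomial in [Y], whose coefficients are
    those of the column system exactly when the weights are affine. *)
Lemma affine_geometric_columns (W Y : {fps K}) :
  affine_weights -> motzkin_ode alpha gamma beta W Y ->
  forall k, column_series alpha gamma beta k = W * Y ^+ k.
Proof.
move=> aff [dW W0 dY Y0]; apply: column_series_unique => k.
split; first by rewrite fpsM_coef0 fps_exp_coef0 W0 Y0 mul1r expr0n.
rewrite fps_derivM dW /column_rhs; case: k => [|k].
  by rewrite expr0 fps_deriv1 expr1; ring.
rewrite fps_derivX dY.
have [_ -> ->] := aff k.+1; have [-> _ _] := aff k.
rewrite !(rmorphD, rmorphM, rmorphB, rmorph_nat) /= !exprS expr0.
ring.
Qed.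

(** Differentiating [H k = H 0 * Y ^+ k] and cancelling [H 0 * Y ^+ k.-1] gives
    a quadratic relation on [Y] for each [k >= 1]; subtracting [k] times the
    one for [k = 1] eliminates the derivative of [Y]. *)
Lemma geometric_columns_affine (Y : {fps K}) :
  Y != 0 -> Y 0%N = 0 ->
  (forall k, column_series alpha gamma beta k
             = column_series alpha gamma beta 0 * Y ^+ k) ->
  affine_weights.
Proof.
move=> Yn0 Y0 geo; set W := column_series alpha gamma beta 0 in geo.
have W0 : W 0%N = 1 by have [] := column_series_ode 0.
have Wn0 : W != 0.
  by apply/eqP => WE; move: W0 (oner_neq0 K); rewrite WE /= => <-; rewrite eqxx.
have dW : fps_deriv W = ((gamma 0)%:S + (beta 0)%:S * Y) * W.
  have [_ ->] := column_series_ode 0.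
  by rewrite /column_rhs -/W geo expr1; ring.
pose Q k := (alpha k)%:S + (gamma k.+1)%:S * Y + (beta k.+1)%:S * Y ^+ 2
  - ((gamma 0)%:S + (beta 0)%:S * Y) * Y - k.+1%:R * fps_deriv Y.
have Q0 k : Q k = 0.
  apply: (fps_mulfI _ (W * Y ^+ k)).
    by rewrite fps_mulf_neq0 // fps_expf_neq0.
  have [_ /esym/eqP] := column_series_ode k.+1.
  rewrite -subr_eq0 /column_rhs !(geo k.+1) (geo k) (geo k.+2).
  rewrite fps_derivM dW fps_derivX !exprS mulr0 => /eqP <-.
  by rewrite /Q expr2; ring.
have free k : [/\ alpha k - k.+1%:R * alpha 0%N = 0,
    gamma k.+1 - (gamma 0%N + k.+1%:R * (gamma 1%N - gamma 0%N)) = 0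
  & beta k.+1 - (beta 0%N + k.+1%:R * (beta 1%N - beta 0%N)) = 0].
  apply: (fps_quadratic_free _ Y) => //.
  transitivity (Q k - k.+1%:R * Q 0%N); last by rewrite !Q0 mulr0 subr0.
  by rewrite /Q !(rmorphD, rmorphM, rmorphB, rmorph_nat) /=; ring.
move=> k; split; first by have [/subr0_eq] := free k.
  by case: k => [|k]; [rewrite mul0r addr0 | have [_ /subr0_eq] := free k].
by case: k => [|k]; [rewrite mul0r addr0 | have [_ _ /subr0_eq] := free k].
Qed.

(** [W] is stored at [true] and [Y] at [false]. *)
Definition ode_rhs (F : bool -> {fps K}) (b : bool) : {fps K} :=
  if b then ((gamma 0)%:S + (beta 0)%:S * F false) * F true
  else (alpha 0)%:S + (gamma 1 - gamma 0)%:S * F false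
       + (beta 1 - beta 0)%:S * F false ^+ 2.

Lemma ode_rhs_causal : causal K bool ode_rhs.
Proof.
move=> n F G FG b m ltmn.
have FGm c p : (p <= m)%N -> F c p = G c p.
  by move=> lepm; apply: FG; apply: leq_ltn_trans ltmn.
case: b; rewrite /ode_rhs.
  apply: eq_fpsM_coef => p lepm; last exact: FGm.
  by rewrite !fpsD_coef !fpsCM_coef FGm.
rewrite !fpsD_coef !fpsCM_coef FGm // !expr2.
by congr (_ + _ * _); apply: eq_fpsM_coef => p; apply: FGm.
Qed.

Lemma motzkin_odeE (F : bool -> {fps K}) :
  motzkin_ode alpha gamma beta (F true) (F false) <->
  forall b, F b 0%N = b%:R /\ fps_deriv (F b) = ode_rhs F b.
Proof.
split=> [[dW W0 dY Y0] [] // | ode].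
by have [W0 dW] := ode true; have [Y0 dY] := ode false.
Qed.

Lemma motzkin_ode_exists : exists W Y, motzkin_ode alpha gamma beta W Y.
Proof.
have [F ode] := causal_ode_exists K charK bool _ (fun b => b%:R) ode_rhs_causal.
by exists (F true), (F false); apply/motzkin_odeE.
Qed.

Lemma motzkin_ode_unique W Y W' Y' :
  motzkin_ode alpha gamma beta W Y -> motzkin_ode alpha gamma beta W' Y' ->
  W' = W /\ Y' = Y.
Proof.
pose couple (A B : {fps K}) (b : bool) := if b then A else B.
move=> /(motzkin_odeE (couple W Y)) ode /(motzkin_odeE (couple W' Y')) ode'.
have E := causal_ode_unique K charK bool _ _ _ _ ode_rhs_causal ode' ode.
by split; [apply: (E true) | apply: (E false)].
Qed.

Lemma motzkin_gf_geometric (W Y : {fps K}) :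
  (forall k, column_series alpha gamma beta k = W * Y ^+ k) ->
  motzkin_gf alpha gamma beta = W%:S / (1 - fpsX * Y%:S).
Proof.
move=> geo; apply: (canRL (mulrK (fps_unit_1BX Y))).
have gfE k : motzkin_gf alpha gamma beta k = W * Y ^+ k by rewrite -geo.
rewrite mulrC mulrBl mul1r -mulrA; apply/fpsP => -[|k];
  rewrite fpsD_coef fpsN_coef fpsXM_coef ?fpsCM_coef !gfE /=.
  by rewrite expr0 mulr1 subr0.
by rewrite exprS; ring.
Qed.

End Paths.

Theorem theorem4p1 (K : fieldType) (charK : [pchar K] =i pred0)
    (alpha gamma beta : nat -> K)
    (H1_neq0 : column_series alpha gamma beta 1 != 0) :
  let H := column_series alpha gamma beta in
  let geometric_columns :=
    exists Y : {fps K}, Y 0%N = 0 /\ forall k : nat, H k = H 0%N * Y ^+ k in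
  let affine_weights :=
    forall k : nat,
      [/\ alpha k = k.+1%:R * alpha 0%N,
          gamma k = gamma 0%N + k%:R * (gamma 1%N - gamma 0%N)
        & beta k = beta 0%N + k%:R * (beta 1%N - beta 0%N)] in
  (geometric_columns <-> affine_weights) /\
  (affine_weights ->
   exists W Y : {fps K},
     [/\ W = H 0%N,
         motzkin_ode alpha gamma beta W Y,
         forall W' Y' : {fps K},
           motzkin_ode alpha gamma beta W' Y' -> W' = W /\ Y' = Y,
         forall k : nat, H k = W * Y ^+ k
       & motzkin_gf alpha gamma beta = W%:S / (1 - fpsX * Y%:S)]).
Proof.
move=> H geometric affine.
have [W [Y ode]] := motzkin_ode_exists K alpha gamma beta charK.
have geoWY (aff : affine) := affine_geometric_columns K alpha gamma beta charK W Y aff ode.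
have W_H0 (aff : affine) : W = H 0%N by rewrite [H _](geoWY aff) expr0 mulr1.
split; first split.
- case=> Z [Z0 geo]; apply: (geometric_columns_affine _ _ _ _ charK Z) => //.
  apply: contraNneq H1_neq0 => ZE.
  by rewrite [column_series _ _ _ _](geo 1%N) ZE expr1 mulr0.
- move=> aff; exists Y; rewrite -(W_H0 aff).
  by split=> [|k]; [case: ode | apply: geoWY].
- move=> aff; exists W, Y; split.
  + exact: W_H0.
  + exact: ode.
  + by move=> W' Y'; apply: motzkin_ode_unique.
  + exact: geoWY.
  + by apply: motzkin_gf_geometric; apply: geoWY.
Qed.
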